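(* Let $(X,\tau,\mathcal{I},\mathfrak{a})$ be an ideal-aura topological space. (i) If $\mathcal{I}=\{\emptyset\}$, then $A^{\mathfrak{a}}(\mathcal{I})=\operatorname{cl}_{\mathfrak{a}}(A)$ for all $A\subseteq X$, $\operatorname{cl}^{*}_{\mathfrak{a}}=\operatorname{cl}_{\mathfrak{a}}$, and $\tau^{*}_{\mathfrak{a}}=\tau_{\mathfrak{a}}$. (ii) If $\mathcal{I}=\mathcal{P}(X)$, then $A^{\mathfrak{a}}(\mathcal{I})=\emptyset$ for all $A\subseteq X$, $\operatorname{cl}^{*}_{\mathfrak{a}}$ is the identity (i.e. $\operatorname{cl}^{*}_{\mathfrak{a}}(A)=A$ for all $A\subseteq X$), and $\tau^{*}_{\mathfrak{a}}=\mathcal{P}(X)$. (iii) If $\mathfrak{a}(x)=X$ for all $x\in X$, then for $A\subseteq X$, $A^{\mathfrak{a}}(\mathcal{I})=X$ whenever $A\notin\mathcal{I}$, and $A^{\mathfrak{a}}(\mathcal{I})=\emptyset$ when $A\in\mathcal{I}$.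
   Context: An ideal on a set $X$ is a non-empty collection $\mathcal{I}\subseteq\mathcal{P}(X)$ closed under taking subsets and finite unions. A scope function on a topological space $(X,\tau)$ is a function $\mathfrak{a}:X\to\tau$ with $x\in\mathfrak{a}(x)$ for every $x\in X$. An ideal-aura topological space $(X,\tau,\mathcal{I},\mathfrak{a})$ is a topological space $(X,\tau)$ with an ideal $\mathcal{I}$ on $X$ and a scope function $\mathfrak{a}:X\to\tau$. For $A\subseteq X$: $A^{\mathfrak{a}}(\mathcal{I})=\{x\in X:\mathfrak{a}(x)\cap A\notin\mathcal{I}\}$; $\operatorname{cl}_{\mathfrak{a}}(A)=\{x\in X:\mathfrak{a}(x)\cap A\neq\emptyset\}$; $\operatorname{cl}^{*}_{\mathfrak{a}}(A)=A\cup A^{\mathfrak{a}}(\mathcal{I})$; $\operatorname{cl}^{*0}_{\mathfrak{a}}(A)=A$, $\operatorname{cl}^{*(n+1)}_{\mathfrak{a}}(A)=\operatorname{cl}^{*}_{\mathfrak{a}}(\operatorname{cl}^{*n}_{\mathfrak{a}}(A))$, $\operatorname{cl}^{*\infty}_{\mathfrak{a}}(A)=\bigcup_{n=0}^{\infty}\operatorname{cl}^{*n}_{\mathfrak{a}}(A)$. Further, $\tau_{\mathfrak{a}}=\{A\subseteq X:\mathfrak{a}(x)\subseteq A\text{ for all }x\in A\}$ and $\tau^{*}_{\mathfrak{a}}=\{A\subseteq X:\operatorname{cl}^{*\infty}_{\mathfrak{a}}(X\setminus A)=X\setminus A\}$. *)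

(* Defs.v *)
From mathcomp Require Import all_boot.
From mathcomp Require Import boolp classical_sets topology.

Set Implicit Arguments.
Unset Strict Implicit.
Unset Printing Implicit Defensive.

Local Open Scope classical_set_scope.

Definition set_ideal (X : Type) (I : set (set X)) : Prop :=
  [/\ I !=set0,
      forall A B, A `<=` B -> I B -> I A
    & forall A B, I A -> I B -> I (A `|` B)].

Definition scope_function (X : topologicalType) (a : X -> set X) : Prop :=
  forall x, open (a x) /\ a x x.

Section AuraOperators.
Variables (X : Type) (I : set (set X)) (a : X -> set X).

(* A^a(I) *)
Definition aura_local (A : set X) : set X := [set x | ~ I (a x `&` A)].

Definition aura_cl (A : set X) : set X := [set x | a x `&` A !=set0].

Definition aura_clstar (A : set X) : set X := A `|` aura_local A.

Definition aura_clstar_iter (n : nat) (A : set X) : set X :=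
  iter n aura_clstar A.

Definition aura_clstar_infty (A : set X) : set X :=
  \bigcup_n aura_clstar_iter n A.

Definition aura_topology : set (set X) :=
  [set A | forall x, A x -> a x `<=` A].

Definition aura_star_topology : set (set X) :=
  [set A | aura_clstar_infty (~` A) = ~` A].

End AuraOperators.

(* Main.v *)
Require Import Defs.
From mathcomp Require Import all_boot.
From mathcomp Require Import boolp classical_sets topology.

Local Open Scope classical_set_scope.

(** The infinite iteration disappears from [aura_star_topology]: by [aura_clstar_infty_fixed], [A]
    belongs to it iff the local function of [~] A[stays inside]~[A]. Each special case then reduces
    to computing [aura_local]. For the ideal [[set set0]] it is [aura_cl], and [aura_cl_setC_sub]
    recovers [aura_topology]; for the full power set it is empty, so every set qualifies; for a
    constant scope [setT], the condition at [x] no longer depends on [x]. *)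

(** The first iterate already contains [aura_local I a B]; conversely, if one step adds nothing to
    [B], no later step does. *)
Lemma aura_clstar_infty_fixed (X : Type) (I : set (set X)) (a : X -> set X)
    (B : set X) :
  aura_clstar_infty I a B = B <-> aura_local I a B `<=` B.
Proof.
split=> [fixB x Bx|locB].
  by rewrite -fixB; exists 1 => //; right.
apply/seteqP; split=> [x [n _]|x Bx]; last by exists 0.
elim: n x => [//|n IHn] x [/IHn//|locx].
(* Monotonicity of [aura_local] is not at hand, so the iterate must equal [B], not merely lie inside
   it. *)
apply: locB; suff <- : aura_clstar_iter I a n B = B by [].
apply/seteqP; split=> [//|y By].
by elim: n {IHn locx} => [//|n IHn]; left.
Qed.

Lemma aura_local_set0 (X : Type) (a : X -> set X) (A : set X) :
  aura_local [set set0] a A = aura_cl a A.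
Proof.
apply/seteqP; split=> x /=; first by move/eqP/set0P.
by move/set0P/eqP.
Qed.

Lemma aura_local_setT (X : Type) (a : X -> set X) (A : set X) :
  aura_local [set: set X] a A = set0.
Proof. by apply/seteqP; split=> x //=; apply. Qed.

Lemma aura_cl_setC_sub (X : Type) (a : X -> set X) (A : set X) :
  aura_cl a (~` A) `<=` ~` A <-> aura_topology a A.
Proof.
split=> [clA x Ax y axy|openA x [y [axy nAy]] Ax].
  by apply: contrapT => nAy; apply: (clA x) Ax; exists y.
exact: nAy (openA x Ax y axy).
Qed.

Theorem corollary4p10 (X : topologicalType) (I : set (set X))
    (a : X -> set X) (idealI : set_ideal I) (scope_a : scope_function a) :
  [/\ I = [set set0] ->
        [/\ forall A : set X, aura_local I a A = aura_cl a A,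
            aura_clstar I a = aura_cl a
          & aura_star_topology I a = aura_topology a],
      I = [set: set X] ->
        [/\ forall A : set X, aura_local I a A = set0,
            forall A : set X, aura_clstar I a A = A
          & aura_star_topology I a = [set: set X]]
    & (forall x : X, a x = [set: X]) ->
        forall A : set X,
          (~ I A -> aura_local I a A = [set: X]) /\
          (I A -> aura_local I a A = set0)].
Proof.
split=> [->|->|aT A].
- split; first exact: aura_local_set0.
    apply/funext => A; rewrite /aura_clstar aura_local_set0.
    (* Since [x] lies in [a x], it witnesses that [aura_cl] contains [A], so the union with [A] is
       absorbed. *)
    by apply/setUidPr => x Ax; exists x; split=> //; case: (scope_a x).
  apply/funext => A; apply/propext.
  by rewrite /aura_star_topology /= aura_clstar_infty_fixed aura_local_set0
     aura_cl_setC_sub.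
- split=> [|A|]; first exact: aura_local_setT.
    by rewrite /aura_clstar aura_local_setT setU0.
  apply/seteqP; split=> A // _.
  by apply/aura_clstar_infty_fixed; rewrite aura_local_setT.
- by split=> IA; apply/seteqP; split=> x //=; rewrite /aura_local /= aT setTI.
Qed.
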